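(* Let $\mu$ be an unconditional log-concave measure on $\mathbb{R}^n$, and let $K \subset \mathbb{R}^n$ be a symmetric convex body. Then $$\mu(K)\,\mu(K^o) \leq \mu(B)^2,$$ where $B = \{x \in \mathbb{R}^n : \|x\|_2 \leq 1\}$ is the Euclidean unit ball (note $B^o = B$).
   Context: A convex body is a compact convex set with non-empty interior; it is symmetric if $K = -K$. The polar body is $K^o := \{y \in \mathbb{R}^n : \langle x, y\rangle \leq 1 \text{ for all } x \in K\}$. A measure $\mu$ on $\mathbb{R}^n$ is log-concave if it is absolutely continuous with density $f_\mu$ such that $\log f_\mu : \mathbb{R}^n \to \mathbb{R}\cup\{-\infty\}$ is concave. It is unconditional (with respect to the standard basis) if $f_\mu(\varepsilon_1 x_1, \dots, \varepsilon_n x_n) = f_\mu(x_1,\dots,x_n)$ for all $x \in \mathbb{R}^n$ and all $\varepsilon \in \{\pm 1\}^n$. *)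

(* Defs.v *)
From HB Require Import structures.
From mathcomp Require Import all_boot all_order all_algebra.
From mathcomp Require Import all_classical all_reals all_analysis.
Set Implicit Arguments. Unset Strict Implicit. Unset Printing Implicit Defensive.
Import Order.TTheory GRing.Theory Num.Theory.
Import numFieldNormedType.Exports.
Local Open Scope classical_set_scope.
Local Open Scope ring_scope.

Definition dotv {R : realType} {n : nat} (x y : 'rV[R]_n) : R :=
  \sum_(i < n) x ord0 i * y ord0 i.

Definition norm2 {R : realType} {n : nat} (x : 'rV[R]_n) : R :=
  Num.sqrt (\sum_(i < n) x ord0 i ^+ 2).

Definition euclid_ball (R : realType) (n : nat) : set 'rV[R]_n :=
  [set x | norm2 x <= 1].

Definition convex_set {R : realType} {n : nat} (K : set 'rV[R]_n) : Prop :=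
  forall x y (t : R), K x -> K y -> 0 <= t <= 1 -> K ((1 - t) *: x + t *: y).

Definition convex_body {R : realType} {n : nat} (K : set 'rV[R]_n) : Prop :=
  compact K /\ convex_set K /\ (K)° !=set0.

Definition symmetric_set {R : realType} {n : nat} (K : set 'rV[R]_n) : Prop :=
  K = [set - x | x in K].

Definition polar {R : realType} {n : nat} (K : set 'rV[R]_n) : set 'rV[R]_n :=
  [set y | forall x, K x -> dotv x y <= 1].

Definition logE {R : realType} {n : nat} (f : 'rV[R]_n -> R) (x : 'rV[R]_n) : \bar R :=
  if 0 < f x then (ln (f x))%:E else -oo%E.

Definition log_concave_density {R : realType} {n : nat} (f : 'rV[R]_n -> R) : Prop :=
  (forall x, 0 <= f x) /\
  forall x y (t : R), 0 <= t <= 1 ->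
    (((1 - t)%:E * logE f x) + (t%:E * logE f y) <= logE f ((1 - t) *: x + t *: y))%E.

Definition unconditional {R : realType} {n : nat} (f : 'rV[R]_n -> R) : Prop :=
  forall (x : 'rV[R]_n) (eps : 'I_n -> bool),
    f (\row_i (if eps i then - x ord0 i else x ord0 i)) = f x.

(* identification of n-tuples (which carry the product Borel sigma-algebra)
   with points of R^n *)
Definition vec_of_tuple {R : realType} {n : nat} (s : n.-tuple R) : 'rV[R]_n :=
  \row_i tnth s i.

(* iterated Lebesgue integral over R^n = R x R^(n-1) (Tonelli) *)
Fixpoint iint {R : realType} (n : nat) : (n.-tuple R -> \bar R) -> \bar R :=
  match n with
  | 0 => fun F => F [tuple]
  | k.+1 => fun F =>
      (\int[@lebesgue_measure R]_t iint (fun s : k.-tuple R => F (cons_tuple t s)))%E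
  end.

(* Lebesgue integral over R^n of a nonnegative function *)
Definition integral_Rn {R : realType} {n : nat} (g : 'rV[R]_n -> \bar R) : \bar R :=
  iint (fun s : n.-tuple R => g (vec_of_tuple s)).

Definition density_measure {R : realType} {n : nat} (f : 'rV[R]_n -> R)
  (A : set 'rV[R]_n) : \bar R :=
  integral_Rn (fun x => (f x * \1_A x)%:E).

(* Main.v *)
(* Write R_i for the reflection flipping the i-th coordinate.  Replace A = K and
   B = K^o, coordinate by coordinate, by A' = {(x + R_i w) / 2 : x, w in A agreeing
   off i} and B' = A'^o.  One-dimensional Prekopa-Leindler on the lines parallel to
   e_i gives mu(A) <= mu(A').  As B' contains (y + R_i v) / 2 for y, v in B with
   y_i = - v_i, and B = - B, Prekopa-Leindler on the hyperplanes y_i = t (Meyer and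
   Pajor's observation) gives mu(B) <= mu(B').  Passing to the bipolar of A' keeps
   everything measurable.  After all coordinates are treated, both sets are
   unconditional; for x in A and y in B with positive coordinates, the point
   (sqrt (x_i y_i))_i lies in the Euclidean ball and
   f(x) f(y) <= f((x + y) / 2)^2 <= f(sqrt (x y))^2, so the multiplicative form of
   Prekopa-Leindler on the positive orthant concludes. *)
Require Import Defs.
From HB Require Import structures.
From mathcomp Require Import all_boot all_order all_algebra.
From mathcomp Require Import all_classical all_reals all_analysis.
From mathcomp Require Import measurable_realfun ring lra.
Import Order.TTheory GRing.Theory Num.Theory.
Import numFieldNormedType.Exports.
Local Open Scope classical_set_scope.
Local Open Scope ring_scope.

Set Implicit Arguments.
Unset Strict Implicit.

(** * Prekopa-Leindler on the line *)

Section one_dim.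
Context {R : realType}.
Notation mu := (@lebesgue_measure R).

Lemma lebesgue_measure_subgraph (a : \bar R) : (0 <= a)%E ->
  mu [set r : R | (0 < r)%R /\ (r%:E < a)%E] = a.
Proof.
case: a => [a| |//] a0.
- rewrite (_ : [set _ | _] = `]0, a[%classic); last first.
    by apply/seteqP; split => r /=; rewrite in_itv/= lte_fin => /andP.
  rewrite lebesgue_measure_itv/= lte_fin sube0.
  by move: a0; rewrite lee_fin le_eqVlt => /predU1P[<-|->]; rewrite ?ltxx.
- rewrite (_ : [set _ | _] = `]0, +oo[%classic); last first.
    apply/seteqP; split => r /=; rewrite in_itv/= ?andbT; first by case.
    by move=> ->; rewrite ltry.
  by rewrite lebesgue_measure_itv/= ltry.
Qed.

Lemma measurable_strict_subgraph d (T : measurableType d) (F : T -> \bar R) :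
  measurable_fun setT F ->
  measurable [set p : T * R | (0 < p.2)%R /\ (p.2%:E < F p.1)%E].
Proof.
move=> mF; apply: (@measurableI _ _ [set p : T * R | (0 < p.2)%R]
    [set p : T * R | (p.2%:E < F p.1)%E]).
  rewrite (_ : [set p | _] = setT `&` snd @^-1` `]0%R, +oo[%classic).
    exact: measurable_snd.
  by rewrite setTI; apply/seteqP; split => p /=; rewrite in_itv/= andbT.
rewrite -[X in measurable X]setTI; apply: measurable_lte => //.
  exact/measurable_EFinP.
exact: measurableT_comp.
Qed.

Lemma layer_cake_weight d (T : measurableType d)
    (m : {sigma_finite_measure set T -> \bar R}) (F w : T -> \bar R) :
  measurable_fun setT F -> (forall x, 0 <= F x)%E ->
  measurable_fun setT w -> (forall x, 0 <= w x)%E ->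
  (\int[m]_x (F x * w x) =
   \int[mu]_(r in `]0%R, +oo[) \int[m]_(x in [set x | r%:E < F x]) w x)%E.
Proof.
move=> mF F0 mw w0.
pose E := [set p : T * R | (0 < p.2)%R /\ (p.2%:E < F p.1)%E].
have mE : measurable E by exact: measurable_strict_subgraph.
have mEx x : measurable [set r | E (x, r)].
  rewrite (_ : [set r | _] = xsection E x); first exact: measurable_xsection.
  by rewrite /xsection; apply/seteqP; split => r /=; rewrite inE.
have mEr r : measurable [set x | E (x, r)].
  rewrite (_ : [set x | _] = ysection E r); first exact: measurable_ysection.
  by rewrite /ysection; apply/seteqP; split => x /=; rewrite inE.
transitivity (\int[m]_x \int[mu]_r ((\1_E (x, r))%:E * w x))%E.
  apply: eq_integral => x _.
  rewrite ge0_integralZr//; last first.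
    by apply/measurable_EFinP; exact: (@measurable_indic _ _ R setT _ (mEx x)).
  congr (_ * _)%E.
  rewrite -[RHS]/(\int[mu]_r (\1_([set r | E (x, r)]) r)%:E)%E.
  rewrite integral_indic ?setIT; last 2 first.
  - exact: measurableT.
  - exact: mEx.
  by rewrite /E/=; apply: esym; exact: lebesgue_measure_subgraph.
pose g (p : T * R) := ((\1_E p)%:E * w p.1)%E.
have mg : measurable_fun setT g.
  apply: emeasurable_funM; last exact: measurableT_comp.
  by apply/measurable_EFinP; exact: measurable_indic.
have g0 p : (0 <= g p)%E by rewrite mule_ge0// lee_fin.
rewrite (@fubini_tonelli _ _ _ _ _ m mu g mg g0) /g /=.
rewrite [RHS]integral_mkcond; apply: eq_integral => r _.
rewrite patchE; case: ifPn => [|/negP]; rewrite inE/= in_itv/= andbT => r0.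
  rewrite [RHS]integral_mkcond; apply: eq_integral => x _.
  rewrite patchE; case: ifPn => [|/negP]; rewrite inE/= => Fx; rewrite indicE.
    by rewrite mem_set ?mul1e.
  by rewrite memNset ?mul0e// => -[].
apply: integral0_eq => x _.
by rewrite indicE memNset ?mul0e// => -[].
Qed.

Lemma layer_cake d (T : measurableType d)
    (m : {sigma_finite_measure set T -> \bar R}) (F : T -> \bar R) :
  measurable_fun setT F -> (forall x, 0 <= F x)%E ->
  (\int[m]_x F x = \int[mu]_(r in `]0%R, +oo[) m [set x | r%:E < F x])%E.
Proof.
move=> mF F0; under eq_integral do rewrite -[F _]mule1.
rewrite layer_cake_weight//; apply: eq_integral => r _.
rewrite integral_cst ?mul1e//.
by rewrite -[X in measurable X]setTI; exact: measurable_lte.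
Qed.

Lemma lebesgue_measure_half (a : R) (A : set R) : measurable A ->
  ((2%:E * mu [set z | A (2 * z - a)%R])%E = mu A)%E.
Proof.
move=> mA.
pose phi : measurableTypeR R -> measurableTypeR R := fun z => (2 * z - a)%R.
have mphi : measurable_fun setT phi.
  by apply: measurable_funB => //; exact: measurable_funM.
pose m := measure_function_pushforward__canonical__measure_function_Measure mu mphi.
transitivity (mscale (2%:nng : {nonneg R}) m A) => //.
apply/esym/lebesgue_measure_unique => //= _ [[x y]] _ <-.
rewrite /mscale /= /pushforward /phi /=.
rewrite (_ : _ @^-1` _ = `](x + a)/2, (y+a)/2]%classic); last first.
  apply/seteqP; split => z /=; rewrite !in_itv/= => /andP[? ?]; apply/andP; split; lra.
rewrite !lebesgue_measure_itv/= !lte_fin.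
have -> : ((x + a) / 2 < (y + a) / 2) = (x < y) by apply/idP/idP => ?; lra.
case: ifPn => // _; last by rewrite mule0.
by rewrite -!EFinB -EFinM; congr EFin; lra.
Qed.

Lemma lebesgue_measure_le_sup (A : set R) (c : \bar R) : measurable A ->
  A !=set0 ->
  (forall a, A a -> mu (A `&` [set x | x <= a]%R) <= c)%E -> (mu A <= c)%E.
Proof.
move=> mA A0 H.
pose I n : set R := `[- n%:R, n%:R]%classic.
have Hle : forall a, measurable [set x : R | (x <= a)%R].
  by move=> a; rewrite -set_itvNyc.
have mI n : measurable (A `&` I n).
  by apply: measurableI => //; exact: measurable_itv.
have c0 : (0 <= c)%E by case: A0 => a Aa; exact: le_trans (H a Aa).
have bnd n : (mu (A `&` I n) <= c)%E.
  have [->|/eqP/set0P[b Bb]] := pselect (A `&` I n = set0); first by rewrite measure0.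
  apply/lee_addgt0Pr => e e0.
  set B := A `&` I n.
  have hB : has_sup B.
    split; first by exists b.
    by exists n%:R => x [_]; rewrite /I/= in_itv/= => /andP[].
  have [a [Aa _] ae] := sup_adherent e0 hB.
  have sub : B `<=` (A `&` [set x | x <= a]%R) `|` `[a, sup B]%classic.
    move=> x Bx; have [xa|xa] := leP x a; [left|right].
      by split => //; case: Bx.
    rewrite /= in_itv/= (ltW xa)/=; apply: sup_upper_bound => //.
  apply: (@le_trans _ _ (mu ((A `&` [set x | x <= a]%R) `|` `[a, sup B]%classic))).
    apply: le_measure; rewrite ?inE//; first exact: mI.
    by apply: measurableU; [exact: measurableI mA (Hle a)|exact: measurable_itv].
  apply: (le_trans (measureU2 _ _ _)); [exact: measurableI mA (Hle a)|exact: measurable_itv|].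
  apply: leeD; first exact: H.
  rewrite -[X in (X <= _)%E]/(mu `[a, sup B]%classic) lebesgue_measure_itv/=.
  case: ifPn => _; last by rewrite lee_fin ltW.
  by rewrite -EFinB lee_fin; lra.
have cv := @nondecreasing_cvg_mu _ _ R mu (fun n => A `&` I n) mI.
have UA : \bigcup_n (A `&` I n) = A.
  by rewrite -setI_bigcupr -[RHS]setIT bigcup_itvT.
rewrite UA in cv; have {}cv := cv mA.
rewrite -(cvg_lim _ (cv _))//.
  apply: lime_le; last by apply: nearW => n; exact: bnd.
  apply/cvg_ex; eexists; apply: cv.
  move=> i j ij; apply/subsetPset => x [Ax]; rewrite /I/= in_itv/= => /andP[h1 h2].
  split => //; rewrite /I/= in_itv/=; have : (i%:R <= j%:R :> R) by rewrite ler_nat.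
  by move=> ?; apply/andP; split; lra.
move=> i j ij; apply/subsetPset => x [Ax]; rewrite /I/= in_itv/= => /andP[h1 h2].
split => //; rewrite /I/= in_itv/=; have : (i%:R <= j%:R :> R) by rewrite ler_nat.
by move=> ?; apply/andP; split; lra.
Qed.

Lemma lebesgue_measure_le_inf (A : set R) (c : \bar R) : measurable A ->
  A !=set0 ->
  (forall a, A a -> mu (A `&` [set x | a <= x]%R) <= c)%E -> (mu A <= c)%E.
Proof.
move=> mA [a0 Aa0] H.
have mN (B : set R) : measurable B -> measurable (-%R @^-1` B : set R).
  move=> mB; rewrite -[X in measurable X]setTI.
  by apply: (@oppr_measurable R).
rewrite -(lebesgue_measureN mA) /pushforward.
apply: lebesgue_measure_le_sup; first exact: mN.
  by exists (- a0); rewrite /= opprK.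
move=> a /= Aa; rewrite -lebesgue_measureN ?/pushforward; last first.
  by apply: measurableI; [exact: mN|rewrite -set_itvNyc].
rewrite (_ : _ @^-1` _ = A `&` [set x | - a <= x]); first exact: H.
by apply/seteqP; split => x /=; rewrite opprK lerNl.
Qed.

Lemma brunn_minkowski_line (A B C : set R) :
  measurable A -> measurable B -> measurable C -> A !=set0 -> B !=set0 ->
  (forall a b, A a -> B b -> C ((a + b) / 2)) ->
  (mu A + mu B <= 2%:E * mu C)%E.
Proof.
move=> mA mB mC A0 B0 ABC.
have mle a : measurable [set x : R | x <= a] by rewrite -set_itvNyc.
have mge a : measurable [set x : R | a <= x] by rewrite -set_itvcy.
have mhalf (D : set R) a : measurable D -> measurable [set z : R | D (2 * z - a)].
  move=> mD; rewrite -[X in measurable X]setTI.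
  have : measurable_fun setT (fun z : R => 2 * z - a).
    by apply: measurable_funB => //; exact: measurable_funM.
  exact.
have H a b : A a -> B b ->
    (mu (A `&` [set x | x <= a]%R) + mu (B `&` [set x | b <= x]%R) <= 2%:E * mu C)%E.
  move=> Aa Bb.
  have mA1 := measurableI _ _ mA (mle a); have mB1 := measurableI _ _ mB (mge b).
  rewrite -(lebesgue_measure_half b mA1) -(lebesgue_measure_half a mB1).
  rewrite -ge0_muleDr ?measure_ge0//.
  apply: lee_wpmul2l => //.
  set C1 := [set z | _]; set C2 := [set z | _].
  have mC1 : measurable C1 by exact: mhalf.
  have mC2 : measurable C2 by exact: mhalf.
  pose p := (a + b) / 2.
  have mC2p : measurable (C2 `\` [set p]) by apply: measurableD.
  have leC2 : (mu C2 <= mu (C2 `\` [set p]))%E.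
    rewrite -[leRHS]adde0 -(lebesgue_measure_set1 p).
    apply: le_trans (measureU2 _ _ _) => //.
    apply: le_measure; rewrite ?inE//; first exact: measurableU.
    by move=> z C2z; have [->|/eqP zp] := eqVneq z p; [right|left].
  apply: (le_trans (leeD2l _ leC2)).
  rewrite -measureU//; last first.
    apply/seteqP; split => z //= -[[_ h1] [[_ h2] h3]]; apply: h3; rewrite /p /=.
    by move: h1 h2 => /= *; lra.
  apply: le_measure; rewrite ?inE//; first exact: measurableU.
  move=> z [[Az _]|[[Bz _] _]].
  - have -> : z = ((2 * z - b) + b) / 2 by lra.
    exact: ABC.
  - have -> : z = (a + (2 * z - a)) / 2 by lra.
    exact: ABC.
have [[a0 Aa0] [b0 Bb0]] := (A0, B0).
case E : (2%:E * mu C)%E (H) => [c| |] {}H; [|by rewrite leey|]; last first.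
  have : (0 <= 2%:E * mu C)%E by rewrite mule_ge0.
  by rewrite E.
have finB b : B b -> mu (B `&` [set x | b <= x]%R) \is a fin_num.
  move=> Bb; rewrite ge0_fin_numE ?measure_ge0//.
  apply: le_lt_trans (ltry c); apply: le_trans (H _ _ Aa0 Bb).
  by rewrite leeDr ?measure_ge0.
have HA b : B b -> (mu A + mu (B `&` [set x | b <= x]%R) <= c%:E)%E.
  move=> Bb; rewrite -leeBrDr ?finB//.
  apply: lebesgue_measure_le_sup => // a Aa.
  by rewrite leeBrDr ?finB//; exact: H.
have finA : mu A \is a fin_num.
  rewrite ge0_fin_numE ?measure_ge0//.
  apply: le_lt_trans (ltry c); apply: le_trans (HA _ Bb0).
  by rewrite leeDl ?measure_ge0.
rewrite addeC -leeBrDr//.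
apply: lebesgue_measure_le_inf => // b Bb.
by rewrite leeBrDr// addeC; exact: HA.
Qed.

Lemma measurable_tail d (T : measurableType d)
    (m : {sigma_finite_measure set T -> \bar R}) (F : T -> \bar R) :
  measurable_fun setT F ->
  measurable_fun setT (fun r : R => m [set x | r%:E < F x]%E).
Proof.
move=> mF; pose E := [set p : T * R | (p.2%:E < F p.1)%E].
have mE : measurable E.
  rewrite -[X in measurable X]setTI; apply: measurable_lte => //.
    by apply/measurable_EFinP.
  exact: measurableT_comp.
rewrite (_ : (fun r => _) = m \o ysection E); first exact: measurable_fun_ysection.
apply/funext => r /=; congr (m _); rewrite /ysection.
by apply/seteqP; split => x /=; rewrite inE.
Qed.

Lemma measurable_gt (F : R -> \bar R) (a : \bar R) :
  measurable_fun setT F -> measurable [set x | a < F x]%E.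
Proof.
move=> mF; rewrite -[X in measurable X]setTI.
exact: measurable_lte.
Qed.

(* With both suprema equal to 1, the superlevel sets of F and G at a level r < 1
   are nonempty, so the Brunn-Minkowski inequality applies level by level. *)
Lemma prekopa_leindler_sup1 (F G H : R -> \bar R) :
  measurable_fun setT F -> measurable_fun setT G -> measurable_fun setT H ->
  (forall x, 0 <= F x <= 1)%E -> (forall x, 0 <= G x <= 1)%E ->
  (forall x, 0 <= H x)%E ->
  (forall r : R, r < 1 -> (exists x, r%:E < F x)%E) ->
  (forall r : R, r < 1 -> (exists x, r%:E < G x)%E) ->
  (forall (r x y : R), 0 < r -> (r%:E < F x)%E -> (r%:E < G y)%E ->
     (r%:E < H ((x + y) / 2)%R)%E) ->
  (\int[mu]_x F x + \int[mu]_x G x <= 2%:E * \int[mu]_x H x)%E.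
Proof.
move=> mF mG mH F01 G01 H0 supF supG FGH.
rewrite !(@layer_cake _ _ mu)//; try by move=> x; have /andP[] := F01 x.
  2: by move=> x; have /andP[] := G01 x.
have mD : measurable (`]0%R, +oo[%classic : set R) by exact: measurable_itv.
rewrite -ge0_integralD//; try by apply: measurable_funTS; exact: measurable_tail.
rewrite -ge0_integralZl//; last by apply: measurable_funTS; exact: measurable_tail.
apply: ge0_le_integral => //.
- by move=> r _; rewrite adde_ge0.
- by apply: emeasurable_funD; apply: measurable_funTS; exact: measurable_tail.
- apply: measurable_funeM.
  by apply: measurable_funTS; exact: measurable_tail.
move=> r /=; rewrite in_itv/= andbT => r0.
have [r1|r1] := ltP r 1.
  apply: brunn_minkowski_line; try exact: measurable_gt.
  - exact: supF.
  - exact: supG.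
  - by move=> x y /=; exact: FGH.
rewrite (_ : [set x | _ < F x]%E = set0); last first.
  apply/seteqP; split => x //=; rewrite ltNge => /negP; apply.
  by have /andP[_ h] := F01 x; apply: (le_trans h); rewrite lee_fin.
rewrite (_ : [set x | _ < G x]%E = set0); last first.
  apply/seteqP; split => x //=; rewrite ltNge => /negP; apply.
  by have /andP[_ h] := G01 x; apply: (le_trans h); rewrite lee_fin.
by rewrite !measure0 adde0 mule_ge0.
Qed.

Lemma le_sqr_of_le_mean (a b c : \bar R) : (0 <= a)%E -> (0 <= b)%E ->
  (0 <= c)%E -> (a + b <= 2%:E * c)%E -> (a * b <= c * c)%E.
Proof.
case: c => [c| |//]; last by move=> *; rewrite mulyy leey.
case: a => [a| |//]; case: b => [b| |//]; rewrite ?lee_fin //.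
move=> a0 b0 c0 h; have := sqr_ge0 (a - b).
have : (a + b) * (a + b) <= (2 * c) * (2 * c) by apply: ler_pM => //; exact: addr_ge0.
by rewrite expr2; nra.
Qed.

Lemma prekopa_leindler_bounded (F G H : R -> R) (M : R) :
  measurable_fun setT F -> measurable_fun setT G -> measurable_fun setT H ->
  (forall x, 0 <= F x <= M) -> (forall x, 0 <= G x <= M) ->
  (forall x, 0 <= H x) ->
  (forall x y, F x * G y <= H ((x + y) / 2) ^+ 2) ->
  (\int[mu]_x (F x)%:E * \int[mu]_x (G x)%:E <=
   \int[mu]_x (H x)%:E * \int[mu]_x (H x)%:E)%E.
Proof.
move=> mF mG mH F0 G0 H0 FGH.
have I0 (K : R -> R) : (forall x, 0 <= K x) -> (0 <= \int[mu]_x (K x)%:E)%E.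
  by move=> K0; apply: integral_ge0 => x _; rewrite lee_fin.
have supP (K : R -> R) : (forall x, 0 <= K x <= M) ->
    (\int[mu]_x (K x)%:E = 0)%E \/ 
    exists2 s, 0 < s & (forall x, K x <= s) /\ (forall r, r < 1 -> exists x, r * s < K x).
  move=> KM; have hK : has_sup (range K).
    by split; [exists (K 0), 0|exists M => _ [x _ <-]; have /andP[] := KM x].
  have Ks x : K x <= sup (range K) by apply: sup_upper_bound => //; exists x.
  have [s0|s0] := leP (sup (range K)) 0; [left|right].
    apply: integral0_eq => x _; congr EFin; apply/eqP.
    by rewrite eq_le (le_trans (Ks x))//; have /andP[] := KM x.
  exists (sup (range K)) => //; split => // r r1.
  have := @sup_adherent _ (range K) ((1 - r) * sup (range K)).
  rewrite mulr_gt0// ?subr_gt0// => /(_ isT hK)[_ [x _ <-]] h; exists x.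
  by apply: le_lt_trans h; lra.
have [->|[s s0 [Fs sF]]] := supP F F0; first by rewrite mul0e mule_ge0// I0.
have [->|[t t0 [Gt tG]]] := supP G G0; first by rewrite mule0 mule_ge0// I0.
have scale (K : R -> R) c : measurable_fun setT K -> (forall x, 0 <= K x) -> 0 < c ->
    (\int[mu]_x (K x)%:E = c%:E * \int[mu]_x (c^-1 * K x)%:E)%E.
  move=> mK K0 c0; rewrite -ge0_integralZl//.
  - by apply: eq_integral => x _; rewrite -EFinM mulrA divff ?mul1r// gt_eqF.
  - by apply/measurable_EFinP; exact: measurable_funM.
  - by move=> x _; rewrite lee_fin mulr_ge0// invr_ge0 ltW.
  - by rewrite lee_fin ltW.
pose u := Num.sqrt (s * t).
have st0 : 0 < s * t by rewrite mulr_gt0.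
have u0 : 0 < u by rewrite sqrtr_gt0.
have F0' x : 0 <= F x by have /andP[] := F0 x.
have G0' x : 0 <= G x by have /andP[] := G0 x.
rewrite (scale F s)// (scale G t)// (scale H u)//.
rewrite !muleA -![(_%:E * _ * _%:E)%E]muleAC -!EFinM.
have -> : u * u = s * t by rewrite -expr2 sqr_sqrtr// ltW.
rewrite -!muleA; apply: lee_wpmul2l; first by rewrite lee_fin ltW.
apply: le_sqr_of_le_mean.
- by apply: I0 => x; rewrite mulr_ge0// invr_ge0 ltW.
- by apply: I0 => x; rewrite mulr_ge0// invr_ge0 ltW.
- by apply: I0 => x; rewrite mulr_ge0// invr_ge0 ltW.
apply: prekopa_leindler_sup1.
- by apply/measurable_EFinP; exact: measurable_funM.
- by apply/measurable_EFinP; exact: measurable_funM.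
- by apply/measurable_EFinP; exact: measurable_funM.
- move=> x; rewrite !lee_fin; apply/andP; split.
    by rewrite mulr_ge0// invr_ge0 ltW.
  by rewrite mulrC ler_pdivrMr// mul1r.
- move=> x; rewrite !lee_fin; apply/andP; split.
    by rewrite mulr_ge0// invr_ge0 ltW.
  by rewrite mulrC ler_pdivrMr// mul1r.
- by move=> x; rewrite lee_fin mulr_ge0// invr_ge0 ltW.
- by move=> r /sF[x h]; exists x; rewrite lte_fin mulrC ltr_pdivlMr.
- by move=> r /tG[x h]; exists x; rewrite lte_fin mulrC ltr_pdivlMr.
move=> r x y r0; rewrite !lte_fin ![_^-1 * _]mulrC !ltr_pdivlMr// => h1 h2.
have ru0 : 0 <= r * u by rewrite mulr_ge0 ?ltW.
rewrite -(ltr_pXn2r (_ : (0 < 2)%N)) ?nnegrE//.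
apply: lt_le_trans (FGH x y); rewrite exprMn sqr_sqrtr ?ltW//.
have := ltr_pM _ _ h1 h2; rewrite !mulr_ge0 ?ltW// => /(_ isT isT).
by rewrite expr2 mulrACA.
Qed.

Lemma lime_mul_le (a b c : \bar R) (u v : nat -> \bar R) :
  (0 <= c)%E -> (0 <= a)%E -> (0 <= b)%E ->
  u @ \oo --> a -> v @ \oo --> b -> (forall n, u n * v n <= c)%E ->
  (a * b <= c)%E.
Proof.
move=> c0; rewrite [(0 <= a)%E]le_eqVlt => /predU1P[<-|a0]; first by rewrite mul0e.
rewrite [(0 <= b)%E]le_eqVlt => /predU1P[<-|b0]; first by rewrite mule0.
move=> ua vb uvc.
have ab : (a *? b)%E.
  by apply: neq0_mule_def; rewrite gt_eqF// mule_gt0.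
have cv : (u n * v n)%E @[n --> \oo] --> (a * b)%E by exact: cvgeM.
rewrite -(cvg_lim _ cv)//; apply: lime_le; last exact: nearW.
by apply/cvg_ex; exists (a * b)%E.
Qed.

Lemma prekopa_leindler_line (F G H : R -> \bar R) :
  measurable_fun setT F -> measurable_fun setT G -> measurable_fun setT H ->
  (forall x, 0 <= F x)%E -> (forall x, 0 <= G x)%E -> (forall x, 0 <= H x)%E ->
  (forall x y, F x * G y <= H ((x + y) / 2)%R * H ((x + y) / 2)%R)%E ->
  (\int[mu]_x F x * \int[mu]_x G x <= \int[mu]_x H x * \int[mu]_x H x)%E.
Proof.
move=> mF mG mH F0 G0 H0 FGH.
pose tr (K : R -> \bar R) (n : nat) x := Order.min (K x) (n%:R%:E).
have mtr K n : measurable_fun setT K -> measurable_fun setT (tr K n).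
  by move=> mK; apply: measurable_mine.
have tr0 K n x : (forall x, 0 <= K x)%E -> (0 <= tr K n x)%E.
  by move=> K0; rewrite /tr le_min K0 lee_fin ler0n.
have trn K n x : (forall x, 0 <= K x)%E -> (tr K n x <= n%:R%:E)%E.
  by move=> K0; rewrite /tr ge_min lexx orbT.
have trfin K n x : (forall x, 0 <= K x)%E -> tr K n x \is a fin_num.
  by move=> K0; rewrite ge0_fin_numE ?tr0// (le_lt_trans (trn _ _ _ K0))// ltry.
have cvtr K : measurable_fun setT K -> (forall x, 0 <= K x)%E ->
    (fun n => \int[mu]_x tr K n x)%E @ \oo --> (\int[mu]_x K x)%E.
  move=> mK K0.
  have /= := @cvg_monotone_convergence _ _ R mu setT measurableT (fun n x => tr K n x).
  move=> /(_ (fun n => mtr K n mK) (fun n x _ => tr0 K n x K0)).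
  rewrite (_ : (fun x => limn _) = K).
    apply; move=> x _ m n mn; rewrite /tr le_min2 ?lee_fin ?ler_nat//.
  apply/funext => x; apply/cvg_lim => //.
  case E : (K x) (K0 x) => [r| |//] r0.
    apply: cvg_near_cst; near=> n; rewrite /tr E; apply/min_idPl.
    by rewrite lee_fin; near: n; exact: nbhs_infty_ger.
  rewrite /tr E (_ : (fun n => _) = EFin \o (fun n => n%:R)).
    by apply/cvgeryP; exact: cvgr_idn.
  by apply/funext => n; apply/min_idPr; rewrite leey.
apply: (@lime_mul_le _ _ _ (fun n => \int[mu]_x tr F n x)%E
   (fun n => \int[mu]_x tr G n x)%E).
- by rewrite mule_ge0// integral_ge0.
- exact: integral_ge0.
- exact: integral_ge0.
- exact: cvtr.
- exact: cvtr.
move=> n.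
have leH : (\int[mu]_x tr H n x <= \int[mu]_x H x)%E.
  apply: ge0_le_integral => //.
  - by move=> x _; exact: tr0.
  - exact: mtr.
  - by move=> x _; rewrite /tr ge_min lexx.
apply: (@le_trans _ _ (\int[mu]_x tr H n x * \int[mu]_x tr H n x)%E); last first.
  by apply: lee_pmul => //; apply: integral_ge0 => x _; exact: tr0.
have E K : (forall x, 0 <= K x)%E ->
    (\int[mu]_x tr K n x = \int[mu]_x (fine (tr K n x))%:E)%E.
  by move=> K0; apply: eq_integral => x _; rewrite fineK// trfin.
rewrite !E//; apply: (@prekopa_leindler_bounded _ _ _ n%:R).
- exact: measurableT_comp (mtr _ _ mF).
- exact: measurableT_comp (mtr _ _ mG).
- exact: measurableT_comp (mtr _ _ mH).
- by move=> x; rewrite fine_ge0 ?tr0//= -lee_fin fineK ?trfin// trn.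
- by move=> x; rewrite fine_ge0 ?tr0//= -lee_fin fineK ?trfin// trn.
- by move=> x; rewrite fine_ge0 ?tr0.
move=> x y; rewrite -lee_fin expr2 !EFinM !fineK ?trfin//.
have := FGH x y; set z := (x + y) / 2 => h.
rewrite {3 4}/tr; case: (leP (H z) n%:R%:E) => _.
  apply: le_trans h; apply: lee_pmul; rewrite ?tr0//.
    by rewrite /tr ge_min lexx.
  by rewrite /tr ge_min lexx.
by apply: lee_pmul; rewrite ?tr0// trn.
Unshelve. all: by end_near. Qed.

Lemma integral_expRNy (c : R) :
  (\int[mu]_(u in `]-oo, c]) (expR u)%:E = (expR c)%:E)%E.
Proof.
rewrite -[c]opprK ge0_integration_by_substitutionNy; last 2 first.
- by apply: continuous_subspaceT; exact: continuous_expR.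
- by move=> x _; exact: expR_ge0.
have d (x : R) : is_derive x (1 : R) (fun x : R => - expR (- x)) (expR (- x)).
  have h : is_derive x (1 : R) (expR \o -%R) (expR (- x) * -1).
    exact: is_derive1_comp.
  rewrite (_ : expR (- x) = - (expR (- x) * -1)); last by rewrite mulrN1 opprK.
  exact: is_deriveN.
have cN : continuous (fun x : R => expR (- x)).
  by move=> x; apply: continuous_comp; [exact: opp_continuous|exact: continuous_expR].
rewrite (@ge0_continuous_FTC2y _ _ (fun x => - expR (- x)) _ 0).
- by rewrite sub0e -EFinN opprK opprK.
- by move=> x _; exact: expR_ge0.
- exact: continuous_subspaceT.
- rewrite -oppr0; apply: cvgN; exact: cvgr_expR.
- by move=> x _.
- apply: cvg_at_right_filter; apply: cvgN; exact: cN.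
- by move=> x _; rewrite derive1E derive_val.
Qed.

Lemma integral_expR_itv (x y : R) : x <= y ->
  (\int[mu]_(u in `[x, y]) (expR u)%:E = (expR y - expR x)%:E)%E.
Proof.
rewrite le_eqVlt => /predU1P[<-|xy].
  by rewrite set_itv1 integral_set1 subrr.
rewrite (@continuous_FTC2 _ _ expR)//.
- by apply: continuous_subspaceT; exact: continuous_expR.
- split.
  + by move=> z _; exact: derivable_expR.
  + by apply: cvg_at_right_filter; exact: continuous_expR.
  + by apply: cvg_at_left_filter; exact: continuous_expR.
- by move=> z _; rewrite derive1E derive_val.
Qed.

End one_dim.


Section exp_measure.
Context {R : realType}.
Notation mu := (@lebesgue_measure R).

Definition exp_measure (A : set (measurableTypeR R)) : \bar R :=
  (\int[mu]_(u in (@expR R : R -> measurableTypeR R) @^-1` A) (expR u)%:E)%E.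

Let exp_measure0 : exp_measure set0 = 0%E.
Proof. by rewrite /exp_measure preimage_set0 integral_set0. Qed.

Let exp_measure_ge0 A : (0 <= exp_measure A)%E.
Proof. by apply: integral_ge0 => x _; rewrite lee_fin expR_ge0. Qed.

Let exp_measure_sigma_additive : semi_sigma_additive exp_measure.
Proof.
move=> A mA tA mUA; rewrite /exp_measure preimage_bigcup ge0_integral_bigcup//=.
- apply: is_cvg_ereal_nneg_natsum_cond => n _ _.
  by apply: integral_ge0 => x _; rewrite lee_fin expR_ge0.
- have mexp : measurable_fun setT (expR : R -> R) := @measurable_expR R.
  by move=> k; have := mexp measurableT _ (mA k); rewrite setTI.
- by apply: measurable_funTS; apply/measurable_EFinP; exact: measurable_expR.
- apply/trivIsetP => i j _ _ ij; rewrite -preimage_setI.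
  by move/trivIsetP : tA => /(_ i j Logic.I Logic.I ij) ->; rewrite preimage_set0.
Qed.

HB.instance Definition _ := isMeasure.Build _ _ _
  exp_measure exp_measure0 exp_measure_ge0 exp_measure_sigma_additive.

Lemma exp_measureE (A : set R) : measurable A ->
  exp_measure A = mu (A `&` `]0, +oo[%classic).
Proof.
move=> mA.
have mN : measurable (`]-oo, 0%R]%classic : set (measurableTypeR R)).
  exact: measurable_itv.
have muE (B : set R) : measurable B -> mu B = (exp_measure B + mu (B `&` `]-oo, 0%R]%classic))%E.
  move=> mB; rewrite -[RHS](measure_addE exp_measure (mrestr mu mN) B).
  apply: lebesgue_measure_unique => // _ [[x y]] _ <-.
  rewrite -[RHS]/(measure_add exp_measure (mrestr mu mN) _) measure_addE.
  rewrite /= /mrestr /exp_measure.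
  have [y0|y0] := leP y 0.
    rewrite (_ : _ @^-1` _ = set0) ?integral_set0 ?add0e.
      congr (mu _); apply/seteqP; split => z /=; rewrite !in_itv/=; last by case.
      by move=> /andP[xz zy]; rewrite xz zy (le_trans zy y0).
    apply/seteqP; split => z //=; rewrite in_itv/= => /andP[_ h].
    by have := expR_gt0 z; lra.
  have [x0|x0] := leP x 0.
    rewrite (_ : expR @^-1` _ = `]-oo, ln y]%classic).
      rewrite integral_expRNy lnK//.
      rewrite (_ : _ `&` _ = `]x, 0%R]%classic).
        rewrite !lebesgue_measure_itv/= !lte_fin.
        rewrite (le_lt_trans x0 y0); case: ltgtP x0 => // [x0|->] _.
          by rewrite -!EFinB -EFinD sub0r.
        by rewrite -EFinB subr0 adde0.
      apply/seteqP; split => z /=; rewrite !in_itv/=.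
        by move=> [/andP[-> _] ->].
      by move=> /andP[-> z0]; rewrite (le_trans z0 (ltW y0)).
    apply/seteqP; split => z /=; rewrite !in_itv/=.
      by move=> /andP[_ h]; rewrite -ler_expR lnK.
    move=> h; rewrite (le_lt_trans x0 (expR_gt0 z))/=.
    by rewrite -[y]lnK// ler_expR.
  rewrite (_ : _ `&` _ = set0) ?measure0 ?adde0; last first.
    by apply/seteqP; split => z //= []; rewrite !in_itv/= => /andP[? _] ?; lra.
  rewrite (_ : expR @^-1` _ = `]ln x, ln y]%classic); last first.
    apply/seteqP; split => z /=; rewrite !in_itv/= => /andP[h1 h2]; apply/andP; split.
    - by rewrite -ltr_expR lnK.
    - by rewrite -ler_expR lnK.
    - by rewrite -[x]lnK// ltr_expR.
    - by rewrite -[y]lnK// ler_expR.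
  rewrite lebesgue_measure_itv/= lte_fin; have [xy|yx] := ltP x y; last first.
    rewrite set_itv_ge ?integral_set0// -leNgt bnd_simp.
    by rewrite ler_ln// posrE.
  rewrite integral_itv_obnd_cbnd; last first.
    by apply: measurable_funTS; apply/measurable_EFinP; exact: measurable_expR.
  rewrite integral_expR_itv ?lnK// ?posrE// ?EFinB//.
  by rewrite ler_ln ?posrE// ltW.
rewrite muE; last exact: measurableI.
rewrite (_ : _ `&` _ `&` _ = set0) ?measure0 ?adde0; last first.
  by apply/seteqP; split => z //= [[_]]; rewrite !in_itv/= andbT => ? ?; lra.
rewrite /exp_measure; congr (integral _ _ _); apply/seteqP; split => z //=.
  by move=> Az; split => //; rewrite in_itv/= andbT expR_gt0.
by case.
Qed.

Lemma integral_expR_change (F : R -> \bar R) : measurable_fun setT F ->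
  (forall x, 0 <= F x)%E ->
  (\int[mu]_u (F (expR u) * (expR u)%:E) = \int[mu]_(x in `]0%R, +oo[) F x)%E.
Proof.
move=> mF F0.
rewrite layer_cake_weight//; last 2 first.
- by apply: measurableT_comp => //; exact: measurable_expR.
- by apply/measurable_EFinP; exact: measurable_expR.
transitivity (\int[mu]_x (F x * (\1_(`]0%R, +oo[%classic) x)%:E))%E.
  have mI : measurable_fun setT (fun x : R => (\1_(`]0%R, +oo[%classic : set R) x)%:E : \bar R).
    by apply/measurable_EFinP; apply: measurable_indic; exact: measurable_itv.
  transitivity (\int[mu]_(r in `]0%R, +oo[) \int[mu]_(x in [set x | r%:E < F x])
      (\1_(`]0%R, +oo[%classic : set R) x)%:E)%E; last first.
    by apply/esym; apply: layer_cake_weight => // x; rewrite lee_fin.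
  apply: eq_integral => r _.
  have mr : measurable [set x | r%:E < F x]%E.
    by rewrite -[X in measurable X]setTI; exact: measurable_lte.
  rewrite integral_indic//.
  by rewrite setIC; exact: (exp_measureE mr).
rewrite [RHS]integral_mkcond; apply: eq_integral => x _.
by rewrite patchE indicE; case: ifPn => _; rewrite ?mule1 ?mule0.
Qed.

(* Substituting x = e^u turns the geometric mean into the arithmetic mean. *)
Lemma prekopa_leindler_geometric (F G H : R -> \bar R) :
  measurable_fun setT F -> measurable_fun setT G -> measurable_fun setT H ->
  (forall x, 0 <= F x)%E -> (forall x, 0 <= G x)%E -> (forall x, 0 <= H x)%E ->
  (forall x y : R, 0 < x -> 0 < y ->
    (F x * G y <= H (Num.sqrt (x * y))%R * H (Num.sqrt (x * y))%R)%E) ->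
  (\int[mu]_(x in `]0%R, +oo[) F x * \int[mu]_(x in `]0%R, +oo[) G x <=
   \int[mu]_(x in `]0%R, +oo[) H x * \int[mu]_(x in `]0%R, +oo[) H x)%E.
Proof.
move=> mF mG mH F0 G0 H0 FGH.
have mexp (K : R -> \bar R) : measurable_fun setT K ->
    measurable_fun setT (fun u => K (expR u) * (expR u)%:E)%E.
  move=> mK; apply: emeasurable_funM.
    by apply: measurableT_comp => //; exact: measurable_expR.
  by apply/measurable_EFinP; exact: measurable_expR.
rewrite -!integral_expR_change//.
apply: prekopa_leindler_line; try exact: mexp.
- by move=> u; rewrite mule_ge0// lee_fin expR_ge0.
- by move=> u; rewrite mule_ge0// lee_fin expR_ge0.
- by move=> u; rewrite mule_ge0// lee_fin expR_ge0.
move=> u v; have := FGH _ _ (expR_gt0 u) (expR_gt0 v).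
have -> : Num.sqrt (expR u * expR v) = expR ((u + v) / 2).
  rewrite -expRD -[in LHS](_ : (u + v) / 2 + (u + v) / 2 = u + v); last by lra.
  by rewrite expRD -expr2 sqrtr_sqr ger0_norm// expR_ge0.
move=> h; rewrite muleACA [leRHS]muleACA -!EFinM -!expRD.
rewrite (_ : (u + v) / 2 + (u + v) / 2 = u + v); last by lra.
by apply: lee_wpmul2r => //; rewrite lee_fin expR_ge0.
Qed.

End exp_measure.

(** * Iterated integrals *)

Section iterated_integral.
Context {R : realType}.
Notation mu := (@lebesgue_measure R).

Lemma eq_iint k (F G : k.-tuple R -> \bar R) : F =1 G -> iint F = iint G.
Proof. by move=> /funext ->. Qed.

Lemma iint_ge0 k (F : k.-tuple R -> \bar R) :
  (forall s, 0 <= F s)%E -> (0 <= iint F)%E.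
Proof.
elim: k F => [|k IH] F F0 /=; first exact: F0.
by apply: integral_ge0 => t _; apply: IH.
Qed.

Lemma measurable_cons_pair d (T : measurableType d) k (a : T -> R)
    (b : T -> k.-tuple R) :
  measurable_fun setT a -> measurable_fun setT b ->
  measurable_fun setT (fun x => cons_tuple (a x) (b x)).
Proof. by move=> ma mb; exact: (measurable_cons ma mb). Qed.

Lemma measurable_iint k d (T : measurableType d) (F : T * k.-tuple R -> \bar R) :
  measurable_fun setT F -> (forall p, 0 <= F p)%E ->
  measurable_fun setT (fun x => iint (fun s => F (x, s))).
Proof.
elim: k d T F => [|k IH] d T F mF F0 /=.
  by apply: measurableT_comp mF _; exact: measurable_fun_pair.
pose G (q : (T * R) * k.-tuple R) := F (q.1.1, cons_tuple q.1.2 q.2).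
have mG : measurable_fun setT G.
  apply: measurableT_comp mF _; apply: measurable_fun_pair.
    exact: measurableT_comp.
  apply: measurable_cons_pair => //; exact: measurableT_comp.
have mI := IH _ _ G mG (fun q => F0 _).
pose J (p : T * R) := iint (fun s => G (p, s)).
have J0 p : (0 <= J p)%E by apply: iint_ge0 => s; exact: F0.
by have := @measurable_fun_fubini_tonelli_F _ _ T _ R mu J mI J0.
Qed.

Lemma measurable_iint_cons k (F : k.+1.-tuple R -> \bar R) :
  measurable_fun setT F -> (forall p, 0 <= F p)%E ->
  measurable_fun setT (fun t : R => iint (fun s => F (cons_tuple t s))).
Proof.
move=> mF F0.
apply: (@measurable_iint _ _ _ (fun p : R * k.-tuple R => F (cons_tuple p.1 p.2))) => //.
by apply: measurableT_comp mF _; exact: measurable_cons_pair.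
Qed.

Lemma integral_iint_swap k (F : R * k.-tuple R -> \bar R) :
  measurable_fun setT F -> (forall p, 0 <= F p)%E ->
  (\int[mu]_t iint (fun s => F (t, s)) = iint (fun s => \int[mu]_t F (t, s)))%E.
Proof.
elim: k F => [//|k IH] F mF F0 /=.
pose G (p : R * R) := iint (fun s : k.-tuple R => F (p.1, cons_tuple p.2 s)).
have mG : measurable_fun setT G.
  apply: (@measurable_iint _ _ _
    (fun q : (R * R) * k.-tuple R => F (q.1.1, cons_tuple q.1.2 q.2))) => //.
  apply: measurableT_comp mF _; apply: measurable_fun_pair.
    exact: measurableT_comp.
  apply: measurable_cons_pair => //; exact: measurableT_comp.
rewrite (@fubini_tonelli _ _ _ _ _ mu mu G mG (fun p => iint_ge0 (fun s => F0 _))).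
apply: eq_integral => u _.
apply: (IH (fun p => F (p.1, cons_tuple u p.2))) => //.
by apply: measurableT_comp mF _; apply: measurable_fun_pair => //; exact: measurable_cons_pair.
Qed.

Lemma ge0_integral_opp (F : R -> \bar R) : measurable_fun setT F ->
  (forall x, 0 <= F x)%E -> (\int[mu]_t F (- t)%R = \int[mu]_t F t)%E.
Proof.
move=> mF F0.
transitivity (\int[pushforward mu (-%R : _ -> measurableTypeR R)]_t F t)%E.
  by apply: esym; rewrite ge0_integral_pushforward//= preimage_setT.
by apply: eq_measure_integral => //= A mA _; exact: lebesgue_measureN.
Qed.

Lemma iint_opp k (F : k.-tuple R -> \bar R) : measurable_fun setT F ->
  (forall s, 0 <= F s)%E -> iint (fun s => F (map_tuple -%R s)) = iint F.
Proof.
elim: k F => [|k IH] F mF F0 /=.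
  by congr F; apply: val_inj.
rewrite -[RHS](ge0_integral_opp (measurable_iint_cons mF F0)); last first.
  by move=> x; exact: iint_ge0.
apply: eq_integral => t _.
rewrite -[RHS]IH //.
- by apply: eq_iint => s; congr F; apply: val_inj.
- by apply: measurableT_comp mF _; exact: measurable_cons_pair.
Qed.

Lemma iint_prekopa_leindler (m : R -> R -> R) (D : set R) :
  (forall F G H : R -> \bar R,
    measurable_fun setT F -> measurable_fun setT G -> measurable_fun setT H ->
    (forall x, 0 <= F x)%E -> (forall x, 0 <= G x)%E -> (forall x, 0 <= H x)%E ->
    (forall x, ~ D x -> F x = 0%E) -> (forall x, ~ D x -> G x = 0%E) ->
    (forall x y, D x -> D y -> (F x * G y <= H (m x y) * H (m x y))%E) ->
    (\int[mu]_x F x * \int[mu]_x G x <= \int[mu]_x H x * \int[mu]_x H x)%E) ->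
  forall k (F G H : k.-tuple R -> \bar R),
    measurable_fun setT F -> measurable_fun setT G -> measurable_fun setT H ->
    (forall x, 0 <= F x)%E -> (forall x, 0 <= G x)%E -> (forall x, 0 <= H x)%E ->
    (forall x, ~ (forall i, D (tnth x i)) -> F x = 0%E) ->
    (forall x, ~ (forall i, D (tnth x i)) -> G x = 0%E) ->
    (forall x y z, (forall i, D (tnth x i)) -> (forall i, D (tnth y i)) ->
      (forall i, tnth z i = m (tnth x i) (tnth y i)) ->
      (F x * G y <= H z * H z)%E) ->
    (iint F * iint G <= iint H * iint H)%E.
Proof.
move=> PL; elim=> [|k IH] F G H mF mG mH F0 G0 H0 FD GD FGH.
  by apply: FGH; case.
have Dcons t (s : k.-tuple R) : (forall i, D (tnth (cons_tuple t s) i)) <->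
    D t /\ (forall i, D (tnth s i)).
  split=> [h|[Dt Ds] i].
    split; first by have := h ord0; rewrite tnth0.
    by move=> i; have := h (lift ord0 i); rewrite tnthS.
  by case: (unliftP ord0 i) => [j ->|->]; rewrite ?tnthS ?tnth0.
have mc t : measurable_fun setT (fun s : k.-tuple R => cons_tuple t s).
  exact: measurable_cons_pair.
have zero (K : k.+1.-tuple R -> \bar R) : (forall x, ~ (forall i, D (tnth x i)) -> K x = 0%E) ->
    forall t, ~ D t -> iint (fun s => K (cons_tuple t s)) = 0%E.
  move=> KD t Dt; rewrite (_ : (fun s => _) = cst 0%E).
    by elim: (k) => //= k' ->; rewrite integral0.
  by apply/funext => s; apply: KD => /Dcons[].
apply: PL; try exact: measurable_iint_cons.
- by move=> t; exact: iint_ge0.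
- by move=> t; exact: iint_ge0.
- by move=> t; exact: iint_ge0.
- exact: zero.
- exact: zero.
move=> t u Dt Du; apply: IH => //; try exact: measurableT_comp (mc _).
- by move=> x Dx; apply: FD => /Dcons[].
- by move=> x Dx; apply: GD => /Dcons[].
move=> x y z Dx Dy zE; apply: FGH; [exact/Dcons|exact/Dcons|].
by move=> i; case: (unliftP ord0 i) => [j ->|->]; rewrite ?tnthS ?tnth0.
Qed.

Lemma iint_prekopa_leindler_mean k (F G H : k.-tuple R -> \bar R) :
  measurable_fun setT F -> measurable_fun setT G -> measurable_fun setT H ->
  (forall x, 0 <= F x)%E -> (forall x, 0 <= G x)%E -> (forall x, 0 <= H x)%E ->
  (forall x y z, (forall i, tnth z i = (tnth x i + tnth y i) / 2) ->
      (F x * G y <= H z * H z)%E) ->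
  (iint F * iint G <= iint H * iint H)%E.
Proof.
move=> mF mG mH F0 G0 H0 FGH.
apply: (@iint_prekopa_leindler (fun x y => (x + y) / 2) setT) => //.
- move=> {mF mG mH F0 G0 H0 FGH} {}F {}G {}H mF mG mH F0 G0 H0 _ _ FGH.
  by apply: prekopa_leindler_line => // x y; exact: FGH.
- by move=> x [].
- by move=> x [].
- by move=> x y z _ _; exact: FGH.
Qed.

Lemma iint_prekopa_leindler_sqrt k (F G H : k.-tuple R -> \bar R) :
  measurable_fun setT F -> measurable_fun setT G -> measurable_fun setT H ->
  (forall x, 0 <= F x)%E -> (forall x, 0 <= G x)%E -> (forall x, 0 <= H x)%E ->
  (forall x, ~ (forall i, 0 < tnth x i) -> F x = 0%E) ->
  (forall x, ~ (forall i, 0 < tnth x i) -> G x = 0%E) ->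
  (forall x y z, (forall i, 0 < tnth x i) -> (forall i, 0 < tnth y i) ->
    (forall i, tnth z i = Num.sqrt (tnth x i * tnth y i)) ->
    (F x * G y <= H z * H z)%E) ->
  (iint F * iint G <= iint H * iint H)%E.
Proof.
apply: (@iint_prekopa_leindler (fun x y => Num.sqrt (x * y)) [set x : R | 0 < x]).
move=> {}F {}G {}H mF mG mH F0 G0 H0 FD GD FGH.
have E (K : R -> \bar R) : (forall x, ~ 0 < x -> K x = 0%E) ->
    (\int[mu]_x K x = \int[mu]_(x in `]0%R, +oo[) K x)%E.
  move=> KD; rewrite [RHS]integral_mkcond; apply: eq_integral => x _.
  rewrite patchE; case: ifPn => // /negP; rewrite inE/= in_itv/= andbT.
  exact: KD.
have mI : measurable (`]0%R, +oo[%classic : set R) by exact: measurable_itv.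
have leH : (\int[mu]_(x in `]0%R, +oo[) H x <= \int[mu]_x H x)%E.
  by apply: ge0_subset_integral.
rewrite (E F FD) (E G GD); apply: (@le_trans _ _
  (\int[mu]_(x in `]0%R, +oo[) H x * \int[mu]_(x in `]0%R, +oo[) H x)%E).
  by apply: prekopa_leindler_geometric => // x y x0 y0; exact: FGH.
by apply: lee_pmul => //; apply: integral_ge0.
Qed.

Lemma integral_even (F : R -> \bar R) : measurable_fun setT F ->
  (forall x, 0 <= F x)%E -> (forall x, F (- x)%R = F x) ->
  (\int[mu]_t F t = 2%:E * \int[mu]_(t in `]0%R, +oo[) F t)%E.
Proof.
move=> mF F0 Fe.
have mI : measurable (`]0%R, +oo[%classic : set R) by exact: measurable_itv.
rewrite -(setUv (`]0%R, +oo[%classic : set R)) ge0_integral_setU//=; last 3 first.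
- exact: measurableC.
- exact: measurable_funTS.
- by apply/eqP; rewrite setICr.
have -> : (\int[mu]_(x in ~` `]0%R, +oo[) F x = \int[mu]_(x in `]0%R, +oo[) F x)%E.
  rewrite setCitvr [RHS]integral_itv_obnd_cbnd; last exact: measurable_funTS.
  rewrite ge0_integration_by_substitution0//.
  by apply: eq_integral => x _; rewrite Fe.
by rewrite -mule2n mule_natl.
Qed.

Lemma measurable_on_positive k (F : k.-tuple R -> \bar R) :
  measurable_fun setT F ->
  measurable_fun setT (fun s : k.-tuple R =>
    if [forall i, (0 < tnth s i)%R] then F s else 0%E).
Proof.
move=> mF; apply: measurable_fun_ifT => //.
apply: (measurable_fun_bool true); rewrite setTI.
rewrite (_ : _ @^-1` _ = \bigcap_(i in [set: 'I_k]) [set s : k.-tuple R | (0 < tnth s i)%R]).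
  apply: fin_bigcap_measurable => // i _.
  rewrite (_ : [set s | _] = setT `&` (@tnth _ R ^~ i) @^-1` `]0%R, +oo[%classic).
    exact: measurable_tnth.
  by rewrite setTI; apply/seteqP; split => p /=; rewrite in_itv/= andbT.
apply/seteqP; split => s /=; first by move=> /forallP h i _ /=.
by move=> h; apply/forallP => i; exact: h.
Qed.

Lemma iint_even k (F : k.-tuple R -> \bar R) : measurable_fun setT F ->
  (forall s, 0 <= F s)%E ->
  (forall s t, (forall i, `|tnth s i| = `|tnth t i|) -> F s = F t) ->
  (iint F = (2 ^+ k)%:E *
    iint (fun s => if [forall i, (0 < tnth s i)%R] then F s else 0))%E.
Proof.
elim: k F => [|k IH] F mF F0 Fe /=.
  by rewrite expr0 mul1e; case: ifPn => // /forallP[] [].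
have mc t : measurable_fun setT (fun s : k.-tuple R => cons_tuple t s).
  exact: measurable_cons_pair.
have consE t u (s s' : k.-tuple R) : `|t| = `|u| -> (forall i, `|tnth s i| = `|tnth s' i|) ->
    F (cons_tuple t s) = F (cons_tuple u s').
  move=> tu ss; apply: Fe => i.
  by case: (unliftP ord0 i) => [j ->|->]; rewrite ?tnthS ?tnth0.
rewrite integral_even; last 3 first.
- exact: measurable_iint_cons.
- by move=> t; exact: iint_ge0.
- by move=> t; apply: eq_iint => s; apply: consE => //; rewrite normrN.
have mpos : measurable_fun setT (fun s : k.+1.-tuple R =>
    if [forall i, (0 < tnth s i)%R] then F s else 0%E).
  exact: measurable_on_positive.
have pos0 (s : k.+1.-tuple R) : (0 <= if [forall i, (0 < tnth s i)%R] then F s else 0%E)%E.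
  by case: ifP.
rewrite (_ : (\int[mu]_(t in _) _)%E = ((2 ^+ k)%:E * \int[mu]_x
  iint (fun s => if [forall i, (0 < tnth (cons_tuple x s) i)%R] 
    then F (cons_tuple x s) else 0%E))%E).
  by rewrite muleA -EFinM -exprS.
rewrite -ge0_integralZl//; last 2 first.
- exact: (measurable_iint_cons mpos pos0).
- by move=> t _; exact: iint_ge0.
rewrite [LHS]integral_mkcond; apply: eq_integral => t _.
rewrite patchE; case: ifPn => [|/negP]; rewrite inE/= in_itv/= andbT => t0.
  rewrite (IH (fun s => F (cons_tuple t s))) //.
  - congr (_ * _)%E; apply: eq_iint => s.
    congr (if _ then _ else _); apply/forallP/forallP => h i.
      by case: (unliftP ord0 i) => [j ->|->]; rewrite ?tnthS ?tnth0.
    by have := h (lift ord0 i); rewrite tnthS.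
  - exact: measurableT_comp (mc t).
  - by move=> s s' ss; exact: consE.
rewrite (_ : (fun s => _) = cst 0%E).
  by rewrite (_ : iint _ = 0%E) ?mule0//; elim: (k) => //= k' ->; rewrite integral0.
apply/funext => s; case: ifPn => // /forallP/(_ ord0); rewrite tnth0.
by move=> /t0.
Qed.

End iterated_integral.

Section coordinates.
Context {R : realType}.
Notation mu := (@lebesgue_measure R).

(* The integral of a nonnegative function is a supremum over the simple
   functions below it, so this also applies to non-measurable functions. *)
Lemma ge0_le_integral_lower (F G : R -> \bar R) :
  (forall x, 0 <= F x)%E -> (forall x, F x <= G x)%E ->
  (\int[mu]_x F x <= \int[mu]_x G x)%E.
Proof.
move=> F0 FG; have G0 x : (0 <= G x)%E by exact: le_trans (F0 x) (FG x).
rewrite !ge0_integralTE//; apply: le_ereal_sup => _ [h hF <-].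
by exists h => // x; exact: le_trans (hF x) (FG x).
Qed.

Lemma iint_mono k (F G : k.-tuple R -> \bar R) :
  (forall s, 0 <= F s)%E -> (forall s, F s <= G s)%E -> (iint F <= iint G)%E.
Proof.
elim: k F G => [|k IH] F G F0 FG /=; first exact: FG.
by apply: ge0_le_integral_lower => t; [exact: iint_ge0|exact: IH].
Qed.

Definition insert n (i : 'I_n.+1) (t : R) (s : n.-tuple R) : n.+1.-tuple R :=
  [tuple oapp (tnth s) t (unlift i j) | j < n.+1].

Lemma tnth_insert n (i : 'I_n.+1) t (s : n.-tuple R) : tnth (insert i t s) i = t.
Proof. by rewrite tnth_mktuple unlift_none. Qed.

Lemma tnth_insert_lift n (i : 'I_n.+1) t (s : n.-tuple R) j :
  tnth (insert i t s) (lift i j) = tnth s j.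
Proof. by rewrite tnth_mktuple liftK. Qed.

Lemma insert_ord0 n t (s : n.-tuple R) : insert ord0 t s = cons_tuple t s.
Proof.
apply: eq_from_tnth => i.
by case: (unliftP ord0 i) => [j ->|->];
  rewrite ?tnth_insert_lift ?tnth_insert ?tnthS ?tnth0.
Qed.

Lemma insert_lift0 n (i : 'I_n.+1) t u (s : n.-tuple R) :
  insert (lift ord0 i) t (cons_tuple u s) = cons_tuple u (insert i t s).
Proof.
apply: eq_from_tnth => j; case: (unliftP ord0 j) => [j' ->|->]; last first.
  rewrite tnth0 (_ : ord0 = lift (lift ord0 i) ord0); last exact: val_inj.
  by rewrite tnth_insert_lift tnth0.
rewrite tnthS; case: (unliftP i j') => [k ->|->]; last by rewrite !tnth_insert.
rewrite tnth_insert_lift.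
rewrite (_ : lift ord0 (lift i k) = lift (lift ord0 i) (lift ord0 k)).
  by rewrite tnth_insert_lift tnthS.
apply: val_inj => /=; rewrite /bump /=.
by rewrite !add1n ltnS; case: (i <= k)%N.
Qed.

Lemma measurable_insert d (T : measurableType d) n (i : 'I_n.+1) (a : T -> R)
    (b : T -> n.-tuple R) :
  measurable_fun setT a -> measurable_fun setT b ->
  measurable_fun setT (fun x => insert i (a x) (b x)).
Proof.
move=> ma mb; apply/measurable_fun_tnthP => j.
case: (unliftP i j) => [k ->|->].
  rewrite (_ : _ \o _ = fun x => tnth (b x) k).
    exact: (measurableT_comp (measurable_tnth k) mb).
  by apply/funext => x /=; rewrite tnth_insert_lift.
rewrite (_ : _ \o _ = a)//.
by apply/funext => x /=; rewrite tnth_insert.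
Qed.

Lemma iint_insert_outer n (i : 'I_n.+1) (F : n.+1.-tuple R -> \bar R) :
  measurable_fun setT F -> (forall s, 0 <= F s)%E ->
  iint F = (\int[mu]_t iint (fun s => F (insert i t s)))%E.
Proof.
elim: n i F => [|n IH] i F mF F0.
  by rewrite (ord1 i); apply: eq_integral => t _ /=; rewrite insert_ord0.
case: (unliftP ord0 i) => [i' ->|->]; last first.
  have E : (fun t => iint (fun s => F (insert ord0 t s))) =
      (fun t => iint (fun s => F (cons_tuple t s))).
    by apply/funext => t; apply: eq_iint => s; rewrite insert_ord0.
  by rewrite E.
transitivity (\int[mu]_u \int[mu]_t
    iint (fun s => F (cons_tuple u (insert i' t s))))%E.
  have E : (fun u => iint (fun s => F (cons_tuple u s))) =
      (fun u => \int[mu]_t iint (fun s => F (cons_tuple u (insert i' t s))))%E.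
    apply/funext => u; apply: (IH i' (fun s => F (cons_tuple u s))) => //.
    by apply: measurableT_comp mF _; exact: measurable_cons_pair.
  by rewrite -E.
pose G (p : R * R) := iint (fun s => F (cons_tuple p.1 (insert i' p.2 s))).
have mG : measurable_fun setT G.
  apply: (@measurable_iint _ _ _ _
    (fun q : (R * R) * n.-tuple R => F (cons_tuple q.1.1 (insert i' q.1.2 q.2)))) => //.
  apply: measurableT_comp mF _; apply: measurable_cons_pair.
    exact: measurableT_comp.
  by apply: measurable_insert => //; exact: measurableT_comp.
rewrite (@fubini_tonelli _ _ _ _ _ mu mu G mG (fun p => iint_ge0 (fun s => F0 _))).
apply: eq_integral => t _; apply: eq_integral => u _; apply: eq_iint => s.
by rewrite insert_lift0.
Qed.

Lemma iint_insert_inner n (i : 'I_n.+1) (F : n.+1.-tuple R -> \bar R) :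
  measurable_fun setT F -> (forall s, 0 <= F s)%E ->
  iint F = iint (fun s => \int[mu]_t F (insert i t s))%E.
Proof.
move=> mF F0; rewrite (iint_insert_outer i mF F0).
apply: (@integral_iint_swap _ _ (fun p => F (insert i p.1 p.2))) => //.
by apply: measurableT_comp mF _; exact: measurable_insert.
Qed.

Definition upd n (x : 'rV[R]_n) (i : 'I_n) (a : R) : 'rV[R]_n :=
  \row_j (if j == i then a else x ord0 j).

Definition flip n (i : 'I_n) (x : 'rV[R]_n) : 'rV[R]_n := upd x i (- x ord0 i).

Lemma flipE n (i : 'I_n) (x : 'rV[R]_n) j :
  flip i x ord0 j = if j == i then - x ord0 j else x ord0 j.
Proof. by rewrite mxE; case: eqP => // ->. Qed.

(* Passing from [x] to [z] one coordinate at a time. *)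
Lemma coordinatewise n (r : R -> R -> Prop) (P : 'rV[R]_n -> Prop) :
  (forall (x : 'rV[R]_n) i a, r (x ord0 i) a -> P x -> P (upd x i a)) ->
  forall x z : 'rV[R]_n, (forall i, r (x ord0 i) (z ord0 i)) -> P x -> P z.
Proof.
move=> H x z rxz Px.
pose h k : 'rV[R]_n := \row_j (if (j < k)%N then z ord0 j else x ord0 j).
have hP k : (k <= n)%N -> P (h k).
  elim: k => [_|k IH kn].
    by rewrite (_ : h 0%N = x)//; apply/rowP => j; rewrite mxE ltn0.
  pose i := Ordinal kn.
  rewrite (_ : h k.+1 = upd (h k) i (z ord0 i)).
    by apply: H; [rewrite mxE /= ltnn; exact: rxz|exact: IH (ltnW kn)].
  apply/rowP => j; rewrite !mxE ltnS leq_eqVlt -[(j == i)]/((j : nat) == k).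
  case: eqP => //= jk; congr (z _ _); exact: val_inj.
rewrite (_ : z = h n); first exact: hP.
by apply/rowP => j; rewrite mxE ltn_ord.
Qed.

Lemma dotv_flip n (i : 'I_n) (x y : 'rV[R]_n) : dotv (flip i x) y = dotv x (flip i y).
Proof.
apply: eq_bigr => j _; rewrite !flipE; case: eqP => _ //.
by rewrite mulNr mulrN.
Qed.

Lemma dotvC n (x y : 'rV[R]_n) : dotv x y = dotv y x.
Proof. by apply: eq_bigr => j _; rewrite mulrC. Qed.

Lemma dotvNl n (x y : 'rV[R]_n) : dotv (- x) y = - dotv x y.
Proof. by rewrite /dotv -sumrN; apply: eq_bigr => j _; rewrite mxE mulNr. Qed.

Lemma dotvNr n (x y : 'rV[R]_n) : dotv x (- y) = - dotv x y.
Proof. by rewrite dotvC dotvNl dotvC. Qed.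

Lemma polar_polar n (A : set 'rV[R]_n) : A `<=` polar (polar A).
Proof. by move=> x Ax y /(_ _ Ax); rewrite dotvC. Qed.

Lemma polar_opp n (A : set 'rV[R]_n) : (forall x, A x -> A (- x)) ->
  forall y, polar A y -> polar A (- y).
Proof. by move=> AN y Ay x /AN /Ay; rewrite dotvNl dotvNr. Qed.

Lemma polar_flip n (A : set 'rV[R]_n) i : (forall x, A x -> A (flip i x)) ->
  forall y, polar A y -> polar A (flip i y).
Proof. by move=> Ai y Ay x /Ai /Ay; rewrite dotv_flip. Qed.

Lemma measurable_box n (q : n.-tuple R) (e : R) :
  measurable [set s : n.-tuple R | forall i, `|tnth s i - tnth q i| < e].
Proof.
rewrite (_ : [set s | _] = \bigcap_(i in [set: 'I_n])
    [set s : n.-tuple R | `|tnth s i - tnth q i| < e]).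
  apply: fin_bigcap_measurable => // i _.
  rewrite (_ : [set s | _] = setT `&`
    (@tnth _ R ^~ i) @^-1` `](tnth q i - e), (tnth q i + e)[%classic).
    exact: measurable_tnth.
  rewrite setTI; apply/seteqP; split => p /=; rewrite in_itv/= ltr_distl //.
by apply/seteqP; split => s /= h i; [move=> _; exact: h|exact: h].
Qed.

(* The complement of a polar set is a union of boxes with rational centres. *)
Lemma measurable_polar n (X : set 'rV[R]_n) :
  measurable [set s : n.-tuple R | polar X (vec_of_tuple s)].
Proof.
pose U := [set s : n.-tuple R | ~ polar X (vec_of_tuple s)].
suff mU : measurable U.
  rewrite (_ : [set s | _] = ~` U); first exact: measurableC.
  by apply/seteqP; split => s /=; [move=> Ps; apply|exact: contrapT].
pose box (p : n.-tuple rat * nat) := [set s : n.-tuple R |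
  forall i, `|tnth s i - tnth (map_tuple (@ratr R) p.1) i| < p.2.+1%:R^-1].
pose D (p : n.-tuple rat * nat) := if pselect (box p `<=` U) then box p else set0.
rewrite (_ : U = \bigcup_p D p).
  apply: countable_bigcupT_measurable => [|p]; first exact: countableP.
  rewrite /D; case: (pselect (box p `<=` U)) => [_|_] /=; last exact: measurable0.
  exact: measurable_box.
apply/seteqP; split => [s Us|s [p _]]; last first.
  by rewrite /D; case: pselect => // h /h.
have [x Xx xs] : exists2 x, X x & 1 < dotv x (vec_of_tuple s).
  apply: contrapT => h; apply: Us => x Xx; rewrite leNgt; apply/negP => xs.
  by apply: h; exists x.
pose S := \sum_(i < n) `|x ord0 i|.
have S0 : 0 <= S by apply: sumr_ge0.
pose d := (dotv x (vec_of_tuple s) - 1) / (2 * (S + 1)).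
have d0 : 0 < d by rewrite divr_gt0// ?subr_gt0// mulr_gt0//; lra.
have [k kd] : exists k : nat, k.+1%:R^-1 < d.
  have [N _ hN] := near_infty_natSinv_lt (PosNum d0).
  by exists N; exact: (hN N (leqnn N)).
set e := k.+1%:R^-1 : R in kd.
have e0 : 0 < e by rewrite invr_gt0 ltr0n.
have qP i : exists q : rat, `|tnth s i - ratr q| < e.
  have h : tnth s i - e < tnth s i + e by lra.
  have [q] := rat_in_itvoo h; rewrite in_itv/= => /andP[h1 h2].
  by exists q; rewrite ltr_distl; apply/andP; split; lra.
pose q := [tuple projT1 (cid (qP i)) | i < n].
have sbox : box (q, k) s.
  move=> i /=; rewrite tnth_map tnth_mktuple; case: cid => /= r; exact.
exists (q, k) => //; rewrite /D; case: pselect => // -[]; move=> s' s'box s'P.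
have /s'P := Xx; apply/negP; rewrite -ltNge.
have ss' i : `|tnth s i - tnth s' i| <= 2 * e.
  have /= := sbox i; have /= := s'box i; rewrite tnth_map !ltr_distl ler_distl.
  by rewrite -/e => /andP[? ?] /andP[? ?]; apply/andP; split; lra.
have h : dotv x (vec_of_tuple s) - dotv x (vec_of_tuple s') <= S * (2 * e).
  rewrite /dotv -sumrB /S mulr_suml; apply: ler_sum => i _.
  rewrite -mulrBr !mxE; apply: (le_trans (ler_norm _)); rewrite normrM.
  exact: ler_wpM2l.
have : S * (2 * e) <= S * (2 * d) by apply: ler_wpM2l => //; lra.
have -> : S * (2 * d) = (dotv x (vec_of_tuple s) - 1) * (S / (S + 1)).
  by rewrite /d; field; lra.
have : (dotv x (vec_of_tuple s) - 1) * (S / (S + 1)) < dotv x (vec_of_tuple s) - 1.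
  rewrite -[ltRHS]mulr1 ltr_pM2l ?subr_gt0// ltr_pdivrMr ?mul1r; lra.
lra.
Qed.

End coordinates.

(** * Unconditional log-concave densities *)

Section log_concave.
Context {R : realType} {n : nat} (f : 'rV[R]_n -> R).
Hypothesis lcf : log_concave_density f.
Hypothesis uncf : unconditional f.

Let f0 x : 0 <= f x. Proof. by case: lcf. Qed.

Lemma log_concave_midpoint (x y z : 'rV[R]_n) :
  (forall i, z ord0 i = (x ord0 i + y ord0 i) / 2) -> f x * f y <= f z * f z.
Proof.
move=> zE.
have [fx|fx] := leP (f x) 0.
  have -> : f x = 0 by apply/eqP; rewrite eq_le fx f0.
  by rewrite mul0r mulr_ge0.
have [fy|fy] := leP (f y) 0.
  have -> : f y = 0 by apply/eqP; rewrite eq_le fy f0.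
  by rewrite mulr0 mulr_ge0.
have half01 : 0 <= (2^-1 : R) <= 1 by apply/andP; split; lra.
have := lcf.2 x y 2^-1 half01.
rewrite (_ : _ + _ = z); last by apply/rowP => i; rewrite !mxE zE; field.
rewrite /logE fx fy -!EFinM -EFinD.
case: ifPn => fz; last by rewrite leeNy_eq.
rewrite lee_fin => h.
rewrite -ler_ln ?posrE ?mulr_gt0// !lnM ?posrE//.
lra.
Qed.

Lemma unconditional_flip i x : f (flip i x) = f x.
Proof.
rewrite -[RHS](uncf x (fun j => j == i)); congr f.
by apply/rowP => j; rewrite flipE mxE; case: eqP.
Qed.

Lemma unconditional_opp x : f (- x) = f x.
Proof.
by rewrite -[RHS](uncf x (fun=> true)); congr f; apply/rowP => j; rewrite !mxE.
Qed.

Lemma log_concave_upd (x : 'rV[R]_n) i a : `|a| <= `|x ord0 i| -> f x <= f (upd x i a).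
Proof.
move=> ax; have [fx|fx] := leP (f x) 0; first exact: le_trans fx (f0 _).
have [x0|x0] := eqVneq (x ord0 i) 0.
  rewrite (_ : upd x i a = x)//; apply/rowP => j; rewrite mxE; case: eqP => // ->.
  by rewrite x0; move: ax; rewrite x0 normr0 normr_le0 => /eqP.
pose t := (1 - a / x ord0 i) / 2.
have at1 : `|a / x ord0 i| <= 1 by rewrite normf_div ler_pdivrMr ?normr_gt0// mul1r.
have t01 : 0 <= t <= 1 by move: at1; rewrite ler_norml /t => /andP[? ?]; apply/andP; split; lra.
have := lcf.2 x (flip i x) t t01.
rewrite (_ : _ + _ = upd x i a); last first.
  apply/rowP => j; rewrite !mxE; case: eqP => [->|_]; last by ring.
  by rewrite /t; field.
rewrite /logE unconditional_flip fx -!EFinM -EFinD.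
case: ifPn => fz; last by rewrite leeNy_eq.
rewrite lee_fin => h; rewrite -ler_ln ?posrE//.
by apply: le_trans h; rewrite -mulrDl subrK mul1r.
Qed.

Lemma log_concave_unconditional_mono (x z : 'rV[R]_n) :
  (forall i, `|z ord0 i| <= `|x ord0 i|) -> f x <= f z.
Proof.
move=> zx.
apply: (@coordinatewise _ _ (fun b a => `|a| <= `|b|) (fun w => f x <= f w) _ x z zx) => //.
by move=> w i a aw /le_trans; apply; exact: log_concave_upd.
Qed.

End log_concave.

Lemma sqr_le_sqr (R : realType) (a b : \bar R) : (0 <= a)%E -> (0 <= b)%E ->
  (a * a <= b * b)%E -> (a <= b)%E.
Proof.
case: b => [b| |//]; last by move=> *; rewrite leey.
case: a => [a| |//]; last by move=> _ _; rewrite mulyy -EFinM leye_eq.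
rewrite -!EFinM !lee_fin => a0 b0 h; rewrite leNgt; apply/negP => ba.
by have : b * b < a * a by [rewrite ltr_pM]; rewrite ltNge h.
Qed.

Section weighted_indicator.
Context {R : realType} {n : nat} (f : 'rV[R]_n -> R).
Hypothesis mf : measurable_fun setT (fun s : n.-tuple R => f (vec_of_tuple s)).
Hypothesis f0 : forall x, 0 <= f x.

Definition dens (A : set 'rV[R]_n) (s : n.-tuple R) : \bar R :=
  (f (vec_of_tuple s) * \1_A (vec_of_tuple s))%:E.

Lemma dens_ge0 A s : (0 <= dens A s)%E.
Proof. by rewrite lee_fin mulr_ge0. Qed.

Lemma dens_in (A : set 'rV[R]_n) s : A (vec_of_tuple s) -> dens A s = (f (vec_of_tuple s))%:E.
Proof. by move=> As; rewrite /dens indicE mem_set// mulr1. Qed.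

Lemma dens_out (A : set 'rV[R]_n) s : ~ A (vec_of_tuple s) -> dens A s = 0%E.
Proof. by move=> As; rewrite /dens indicE memNset// mulr0. Qed.

Lemma measurable_dens (A : set 'rV[R]_n) :
  measurable [set s : n.-tuple R | A (vec_of_tuple s)] -> measurable_fun setT (dens A).
Proof.
move=> mA; apply/measurable_EFinP; apply: measurable_funM => //.
exact: (@measurable_indic _ _ R setT _ mA).
Qed.

Lemma dens_le_prod (A B C : set 'rV[R]_n) (s t u : n.-tuple R) :
  (A (vec_of_tuple s) -> B (vec_of_tuple t) ->
    C (vec_of_tuple u) /\
    f (vec_of_tuple s) * f (vec_of_tuple t) <= f (vec_of_tuple u) * f (vec_of_tuple u)) ->
  (dens A s * dens B t <= dens C u * dens C u)%E.
Proof.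
move=> H.
have [As|As] := pselect (A (vec_of_tuple s)); last first.
  by rewrite (dens_out As) mul0e mule_ge0// dens_ge0.
have [Bt|Bt] := pselect (B (vec_of_tuple t)); last first.
  by rewrite (dens_out Bt) mule0 mule_ge0// dens_ge0.
have [Cu h] := H As Bt.
by rewrite !dens_in// -!EFinM lee_fin.
Qed.

End weighted_indicator.

(** * Symmetrisation in one coordinate *)

Section steiner_step.
Context {R : realType} {n : nat} (f : 'rV[R]_n.+1 -> R).
Notation mu := (@lebesgue_measure R).
Hypothesis mf : measurable_fun setT (fun s : n.+1.-tuple R => f (vec_of_tuple s)).
Hypothesis lcf : log_concave_density f.
Hypothesis uncf : unconditional f.
Variables (i : 'I_n.+1) (A B : set 'rV[R]_n.+1).

(* The set of (x + R_i w) / 2 for x, w in A on a common line parallel to the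
   i-th axis, where R_i flips the i-th coordinate; for convex A this is the
   Steiner symmetral of A. *)
Definition symmetral : set 'rV[R]_n.+1 :=
  [set z | exists x w, [/\ A x, A w, forall j, j != i -> x ord0 j = w ord0 j,
    forall j, j != i -> z ord0 j = x ord0 j &
    z ord0 i = (x ord0 i - w ord0 i) / 2]].

Let f0 x : 0 <= f x. Proof. by case: lcf. Qed.

Let vec_insert t (s : n.-tuple R) j : vec_of_tuple (insert i t s) ord0 j =
  if unlift i j is Some k then tnth s k else t.
Proof. by rewrite mxE tnth_mktuple; case: unlift. Qed.

Lemma symmetral_line : measurable [set s : n.+1.-tuple R | A (vec_of_tuple s)] ->
  (density_measure f A <= density_measure f (polar (polar symmetral)))%E.
Proof.
move=> mA.
have mA2 := measurable_polar (polar symmetral).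
have mF := measurable_dens mf mA; have mH := measurable_dens mf mA2.
rewrite /density_measure /integral_Rn.
rewrite -[leLHS]/(iint (dens f A)) -[leRHS]/(iint (dens f (polar (polar symmetral)))).
rewrite (iint_insert_inner i mF (dens_ge0 f0 A)) (iint_insert_inner i mH (dens_ge0 f0 _)).
have I0 (C : set 'rV[R]_n.+1) s : (0 <= \int[mu]_t dens f C (insert i t s))%E.
  by apply: integral_ge0 => t _; exact: dens_ge0.
apply: iint_mono => // s; apply: sqr_le_sqr => //.
have mline (F : n.+1.-tuple R -> \bar R) : measurable_fun setT F ->
    measurable_fun setT (fun t : R => F (insert i t s)).
  by move=> mF'; apply: measurableT_comp mF' _; exact: measurable_insert.
rewrite -[X in (_ * X <= _)%E](ge0_integral_opp (mline _ mF)); last by move=> t; exact: dens_ge0.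
apply: prekopa_leindler_line; try by move=> t; exact: dens_ge0.
- exact: mline.
- apply: measurableT_comp (mline _ mF) _; exact: oppr_measurable.
- exact: mline.
move=> x y; apply: dens_le_prod => // Ax Ay; split.
  apply: polar_polar; exists (vec_of_tuple (insert i x s)), (vec_of_tuple (insert i (- y) s)).
  split => //; rewrite ?vec_insert ?unlift_none ?opprK//.
    by move=> j ji; rewrite !vec_insert; case: unliftP ji => [//|->]; rewrite eqxx.
  by move=> j ji; rewrite !vec_insert; case: unliftP ji => [//|->]; rewrite eqxx.
rewrite -(unconditional_flip uncf i (vec_of_tuple (insert i (- y) s))).
apply: log_concave_midpoint => // j; rewrite flipE !vec_insert.
case: unliftP => [k ->|->]; last by rewrite eqxx opprK.
by rewrite eq_sym (negbTE (neq_lift _ _)); field.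
Qed.

Lemma symmetral_polar : measurable [set s : n.+1.-tuple R | B (vec_of_tuple s)] ->
  (forall y, B y -> B (- y)) -> (forall x y, A x -> B y -> dotv x y <= 1) ->
  (density_measure f B <= density_measure f (polar symmetral))%E.
Proof.
move=> mB BN AB.
have mB2 := measurable_polar symmetral.
have mF := measurable_dens mf mB; have mH := measurable_dens mf mB2.
rewrite /density_measure /integral_Rn.
rewrite -[leLHS]/(iint (dens f B)) -[leRHS]/(iint (dens f (polar symmetral))).
rewrite (iint_insert_outer i mF (dens_ge0 f0 _)) (iint_insert_outer i mH (dens_ge0 f0 _)).
apply: ge0_le_integral_lower => t; first by apply: iint_ge0 => s; exact: dens_ge0.
have msl u (F : n.+1.-tuple R -> \bar R) : measurable_fun setT F ->
    measurable_fun setT (fun s => F (insert i u s)).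
  by move=> mF'; apply: measurableT_comp mF' _; exact: measurable_insert.
apply: sqr_le_sqr; try by apply: iint_ge0 => s; exact: dens_ge0.
have -> : (iint (fun s => dens f B (insert i t s)) * iint (fun s => dens f B (insert i t s)) =
    iint (fun s => dens f B (insert i t s)) * iint (fun s => dens f B (insert i (- t) s)))%E.
  congr (_ * _)%E; rewrite -[LHS]iint_opp; last 2 first.
  - exact: msl.
  - by move=> s; exact: dens_ge0.
  apply: eq_iint => s.
  have -> : dens f B (insert i (- t) s) = dens f B (map_tuple -%R (insert i (- t) s)).
    rewrite /dens.
    have -> : vec_of_tuple (map_tuple -%R (insert i (- t) s)) = - vec_of_tuple (insert i (- t) s).
      by apply/rowP => j; rewrite !mxE tnth_map.
    rewrite unconditional_opp//; congr (_ * _)%:E; rewrite !indicE.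
    congr (_%:R); congr nat_of_bool; apply/idP/idP; rewrite !inE; first exact: BN.
    by move=> /BN; rewrite opprK.
  congr (dens f B _); apply: eq_from_tnth => j.
  by case: (unliftP i j) => [k ->|->]; rewrite [RHS]tnth_map ?tnth_insert_lift
    ?tnth_insert ?tnth_map ?opprK.
apply: iint_prekopa_leindler_mean; try (by move=> s; exact: dens_ge0); try exact: msl.
move=> y v u uE; apply: dens_le_prod => // By Bv; split.
  move=> z [x [w [Ax Aw xw zx zi]]].
  have h1 := AB _ _ Ax By; have h2 := AB _ _ Aw Bv.
  rewrite (_ : dotv _ _ = (dotv x (vec_of_tuple (insert i t y)) +
    dotv w (vec_of_tuple (insert i (- t) v))) / 2).
    lra.
  rewrite /dotv -big_split/= mulr_suml; apply: eq_bigr => j _.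
  rewrite !vec_insert; case: unliftP => [k jE|->].
    have ji : j != i by rewrite jE eq_sym neq_lift.
    by rewrite zx// -xw// uE; field.
  by rewrite zi; field.
rewrite -(unconditional_flip uncf i (vec_of_tuple (insert i (- t) v))).
apply: log_concave_midpoint => // j; rewrite flipE !vec_insert.
case: unliftP => [k ->|->]; last by rewrite eqxx opprK; field.
by rewrite eq_sym (negbTE (neq_lift _ _)) uE.
Qed.

Lemma symmetral_opp : (forall x, A x -> A (- x)) ->
  forall z, symmetral z -> symmetral (- z).
Proof.
move=> AN z [x [w [Ax Aw xw zx zi]]].
exists (- x), (- w); split; [exact: AN|exact: AN| | |].
- by move=> j /xw; rewrite !mxE => ->.
- by move=> j /zx; rewrite !mxE => ->.
- by rewrite !mxE zi; field.
Qed.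

Lemma symmetral_flip_same z : symmetral z -> symmetral (flip i z).
Proof.
move=> [x [w [Ax Aw xw zx zi]]]; exists w, x; split => //.
- by move=> j /xw.
- by move=> j ji; rewrite flipE (negbTE ji) zx// xw.
- by rewrite flipE eqxx zi; field.
Qed.

Lemma symmetral_flip j : (forall x, A x -> A (flip j x)) ->
  forall z, symmetral z -> symmetral (flip j z).
Proof.
have [->|ij] := eqVneq j i; first by move=> _; exact: symmetral_flip_same.
move=> Aj z [x [w [Ax Aw xw zx zi]]].
exists (flip j x), (flip j w); split; [exact: Aj|exact: Aj| | |].
- by move=> k /xw; rewrite !flipE => ->.
- by move=> k /zx; rewrite !flipE => ->.
- by rewrite !flipE eq_sym (negbTE ij).
Qed.

End steiner_step.

(** * Unconditional sets *)

Section unconditional_case.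
Context {R : realType} {n : nat} (f : 'rV[R]_n -> R).
Hypothesis mf : measurable_fun setT (fun s : n.-tuple R => f (vec_of_tuple s)).
Hypothesis lcf : log_concave_density f.
Hypothesis uncf : unconditional f.

Let f0 x : 0 <= f x. Proof. by case: lcf. Qed.

Lemma flip_invariant_norm (A : set 'rV[R]_n) :
  (forall i x, A x -> A (flip i x)) ->
  forall x z : 'rV[R]_n, (forall i, `|x ord0 i| = `|z ord0 i|) -> A x -> A z.
Proof.
move=> Ai; apply: (@coordinatewise _ _ (fun a b => `|a| = `|b|)) => x i a.
move=> /eqP; rewrite eqr_norm2 => /orP[/eqP xa|/eqP xa] Ax.
  rewrite (_ : upd x i a = x)//.
  by apply/rowP => j; rewrite mxE -xa; case: eqP => // ->.
rewrite (_ : upd x i a = flip i x); first exact: Ai.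
by rewrite /flip xa opprK.
Qed.

Lemma measurable_euclid_ball :
  measurable [set s : n.-tuple R | euclid_ball (vec_of_tuple s)].
Proof.
pose h (s : n.-tuple R) := \sum_(i < n) tnth s i ^+ 2.
have mh : measurable_fun setT h.
  by apply: measurable_sum => i; apply: measurable_funX; exact: measurable_tnth.
have ballE s : euclid_ball (vec_of_tuple s) <-> h s <= 1.
  rewrite /euclid_ball /norm2 /=.
  rewrite (_ : \sum_(i < n) _ = h s); last by apply: eq_bigr => i _; rewrite mxE.
  by rewrite -[X in _ <= X <-> _]sqrtr1 ler_sqrt.
rewrite (_ : [set s | _] = setT `&` h @^-1` `]-oo, 1%R]%classic); first exact: mh.
by rewrite setTI; apply/seteqP; split => s /=; rewrite in_itv/= => /ballE.
Qed.

Definition on_pos (F : n.-tuple R -> \bar R) (s : n.-tuple R) : \bar R :=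
  if [forall i, (0 < tnth s i)%R] then F s else 0%E.

Lemma unconditional_pair (A B : set 'rV[R]_n) :
  measurable [set s : n.-tuple R | A (vec_of_tuple s)] ->
  measurable [set s : n.-tuple R | B (vec_of_tuple s)] ->
  (forall i x, A x -> A (flip i x)) -> (forall i x, B x -> B (flip i x)) ->
  (forall x y, A x -> B y -> dotv x y <= 1) ->
  (density_measure f A * density_measure f B <=
   density_measure f (@euclid_ball R n) * density_measure f (@euclid_ball R n))%E.
Proof.
move=> mA mB Ai Bi AB.
have mC := measurable_euclid_ball.
have Ci i x : @euclid_ball R n x -> @euclid_ball R n (flip i x).
  rewrite /euclid_ball /norm2 /=; congr (Num.sqrt _ <= 1); apply: eq_bigr => j _.
  by rewrite flipE; case: eqP; rewrite ?sqrrN.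
have E (C : set 'rV[R]_n) : measurable [set s : n.-tuple R | C (vec_of_tuple s)] ->
    (forall i x, C x -> C (flip i x)) ->
    density_measure f C = ((2 ^+ n)%:E * iint (on_pos (dens f C)))%E.
  move=> mC' Ci'; rewrite /density_measure /integral_Rn.
  rewrite -[LHS]/(iint (dens f C)).
  apply: iint_even; [exact: measurable_dens|exact: dens_ge0|].
  move=> s t st; rewrite /dens; congr (_ * _)%:E.
    apply/eqP; rewrite eq_le; apply/andP; split;
      by apply: log_concave_unconditional_mono => // i; rewrite !mxE st.
  rewrite !indicE; congr (_%:R); congr nat_of_bool.
  by apply/idP/idP; rewrite !inE; apply: flip_invariant_norm => // i; rewrite !mxE st.
rewrite (E A)// (E B)// (E (@euclid_ball R n))//.
rewrite muleACA [leRHS]muleACA; apply: lee_wpmul2l.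
  by rewrite -EFinM lee_fin mulr_ge0// exprn_ge0.
have mpos (C : set 'rV[R]_n) : measurable [set s : n.-tuple R | C (vec_of_tuple s)] ->
  measurable_fun setT (on_pos (dens f C)).
  move=> mC'; apply: measurable_on_positive; exact: measurable_dens.
have pos0 (C : set 'rV[R]_n) s : (0 <= on_pos (dens f C) s)%E.
  by rewrite /on_pos; case: ifP => // _; exact: dens_ge0.
have posD (C : set 'rV[R]_n) s : ~ (forall i, 0 < tnth s i) -> on_pos (dens f C) s = 0%E.
  by move=> h; rewrite /on_pos; case: ifPn => // /forallP /h.
apply: iint_prekopa_leindler_sqrt; try exact: mpos; try by move=> s; exact: pos0.
- by move=> s; exact: posD.
- by move=> s; exact: posD.
move=> x y z x0 y0 zE.
have z0 i : 0 < tnth z i by rewrite zE sqrtr_gt0 mulr_gt0.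
have posE (C : set 'rV[R]_n) s : (forall i, 0 < tnth s i) -> on_pos (dens f C) s = dens f C s.
  by move=> h; rewrite /on_pos; case: ifPn => // /forallP[].
rewrite !posE//; apply: dens_le_prod => // Ax By; split.
  rewrite /euclid_ball /norm2 /= -sqrtr1 ler_sqrt//.
  apply: le_trans (AB _ _ Ax By); apply: ler_sum => i _.
  by rewrite !mxE zE sqr_sqrtr// mulr_ge0// ltW.
pose m : 'rV[R]_n := \row_i ((tnth x i + tnth y i) / 2).
apply: (@le_trans _ _ (f m * f m)).
  by apply: log_concave_midpoint => // i; rewrite !mxE.
have fm : f m <= f (vec_of_tuple z).
  apply: log_concave_unconditional_mono => // i; rewrite !mxE zE.
  have xi := x0 i; have yi := y0 i.
  rewrite !ger0_norm ?sqrtr_ge0//; last by lra.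
  rewrite -(ler_pXn2r (_ : (0 < 2)%N)) ?nnegrE ?sqrtr_ge0//; last by lra.
  rewrite sqr_sqrtr; last by rewrite mulr_ge0// ltW.
  by have := sqr_ge0 (tnth x i - tnth y i); rewrite !expr2; lra.
by apply: ler_pM.
Qed.

End unconditional_case.

Unset Implicit Arguments.

Theorem theorem1 (R : realType) (n : nat) (f : 'rV[R]_n -> R)
  (K : set 'rV[R]_n) :
  measurable_fun setT (fun s : n.-tuple R => f (vec_of_tuple s)) ->
  log_concave_density f ->
  unconditional f ->
  convex_body K ->
  symmetric_set K ->
  (density_measure f K * density_measure f (polar K)
     <= density_measure f (@euclid_ball R n) ^+ 2)%E.
Proof.
move=> mf lcf uncf _ symK; have f0 x : 0 <= f x by case: lcf.
have KN x : K x -> K (- x) by move=> Kx; rewrite symK; exists x.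
have [A [B [[mA mB] [AN BN] [Ai Bi] AB [KA KB]]]] : exists A B : set 'rV[R]_n, [/\
    measurable [set s : n.-tuple R | A (vec_of_tuple s)] /\
    measurable [set s : n.-tuple R | B (vec_of_tuple s)],
    (forall x, A x -> A (- x)) /\ (forall x, B x -> B (- x)),
    (forall i x, A x -> A (flip i x)) /\ (forall i x, B x -> B (flip i x)),
    (forall x y, A x -> B y -> dotv x y <= 1) &
    (density_measure f K <= density_measure f A)%E /\
    (density_measure f (polar K) <= density_measure f B)%E].
  suff H k : (k <= n)%N -> exists A B : set 'rV[R]_n, [/\
    measurable [set s : n.-tuple R | A (vec_of_tuple s)] /\
    measurable [set s : n.-tuple R | B (vec_of_tuple s)],
    (forall x, A x -> A (- x)) /\ (forall x, B x -> B (- x)),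
    (forall (i : 'I_n) x, (i < k)%N -> A x -> A (flip i x)) /\
    (forall (i : 'I_n) x, (i < k)%N -> B x -> B (flip i x)),
    (forall x y, A x -> B y -> dotv x y <= 1) &
    (density_measure f K <= density_measure f A)%E /\
    (density_measure f (polar K) <= density_measure f B)%E].
    have [A [B [m N [Ai Bi] AB KAB]]] := H n (leqnn n).
    by exists A, B; split => //; split => i x; [exact: Ai|exact: Bi].
  elim: k => [_|k IH kn].
    exists (polar (polar K)), (polar K); split => //.
    - by split; exact: measurable_polar.
    - by split; do ?exact: polar_opp; apply: polar_opp; exact: polar_opp.
    - by move=> x y Ax /Ax; rewrite dotvC.
    split => //; apply: iint_mono => s; first exact: (dens_ge0 f0 K).
    rewrite lee_fin; apply: ler_wpM2l => //; rewrite !indicE.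
    have [Ks|Ks] := pselect (K (vec_of_tuple s)); last by rewrite memNset.
    by rewrite !mem_set//; exact: polar_polar.
  case: n f K mf lcf uncf symK f0 KN IH kn => [//|n] f K mf lcf uncf symK f0 KN IH kn.
  have [A [B [[mA mB] [AN BN] [Ai Bi] AB [KA KB]]]] := IH (ltnW kn).
  pose i := Ordinal kn; pose S := symmetral i A.
  have SN : forall x, S x -> S (- x) by exact: symmetral_opp.
  have Si (j : 'I_n.+1) x : (j < k.+1)%N -> S x -> S (flip j x).
    rewrite ltnS leq_eqVlt => /orP[/eqP jk|jk].
      by rewrite (_ : j = i); [exact: symmetral_flip_same|exact: val_inj].
    by apply: symmetral_flip => {}x; exact: Ai.
  exists (polar (polar S)), (polar S); split.
  - by split; exact: measurable_polar.
  - by split; do ?exact: polar_opp; apply: polar_opp; exact: polar_opp.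
  - split=> j x jk; last by apply: polar_flip => {}x; exact: Si.
    by apply: polar_flip => {}x; apply: polar_flip => {}x; exact: Si.
  - by move=> x y Ax /Ax; rewrite dotvC.
  - split; first by apply: le_trans KA _; exact: symmetral_line.
    by apply: le_trans KB _; exact: symmetral_polar.
have D0 (C : set 'rV[R]_n) : (0 <= density_measure f C)%E.
  by apply: iint_ge0 => s; exact: (dens_ge0 f0 C).
rewrite expe2; apply: le_trans (unconditional_pair mf lcf uncf mA mB Ai Bi AB).
exact: lee_pmul.
Qed.
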